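(* Let $\mathcal{L}$ be a g-language and let $\mathcal{L}{\upharpoonright}$ denote its projection (a communicating system). Then: (1) If $\mathcal{L}{\upharpoonright}$ is correct with respect to $\mathcal{L}$, i.e. $[\![\mathcal{L}{\upharpoonright}]\!] \subseteq \mathcal{L}$, then $\mathcal{L}$ is closed under unknown information (CUI). (2) If $\mathcal{L}$ is standard or continuous and $\mathcal{L}$ is CUI, then $\mathcal{L}{\upharpoonright}$ is correct with respect to $\mathcal{L}$, i.e. $[\![\mathcal{L}{\upharpoonright}]\!] \subseteq \mathcal{L}$.
   Context: Fix disjoint sets $\mathfrak{P}$ (participants) and $\mathfrak{M}$ (messages). The alphabet of interactions is $\Sigma_{int}=\{A\to B{:}m \mid A\neq B\in\mathfrak{P}, m\in\mathfrak{M}\}$; the alphabet of actions is $\Sigma_{act}=\{AB!m,\ AB?m \mid A\neq B\in\mathfrak{P}, m\in\mathfrak{M}\}$ ($AB!m$: $A$ sends $m$ to $B$; $AB?m$: $B$ receives $m$ from $A$). For an alphabet $\Sigma$, $\Sigma^\infty=\Sigma^\star\cup\Sigma^\omega$ (finite and infinite words); concatenation of an infinite word with anything is that infinite word; $\preceq$ is the prefix order and $\prec$ strict prefix. A language $L\subseteq\Sigma^\infty$ is prefix-closed if it contains all prefixes of its words. $\mathrm{ptp}(A\to B{:}m)=\mathrm{ptp}(AB!m)=\mathrm{ptp}(AB?m)=\{A,B\}$, extended to words and sets of words by union. A g-language is a prefix-closed $\mathcal{L}\subseteq\Sigma_{int}^\infty$ with $\mathrm{ptp}(\mathcal{L})$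 finite. An l-language is a prefix-closed subset of $\Sigma_{act}^\infty$ with finitely many participants; it is $A$-local if all its actions have subject $A$ (the subject of $AB!m$ is $A$, of $AB?m$ is $B$). A (communicating) system over a finite $P\subseteq\mathfrak{P}$ is a map $S$ assigning to each $A\in P$ an $A$-local l-language $S(A)\neq\{\varepsilon\}$ with $\mathrm{ptp}(S(A))\subseteq P$. Projection: $(A\to B{:}m){\upharpoonright}_A=AB!m$, $(A\to B{:}m){\upharpoonright}_B=AB?m$, $(A\to B{:}m){\upharpoonright}_C=\varepsilon$ for $C\notin\{A,B\}$, extended homomorphically (letter by letter) to finite and infinite interaction words and to sets of words. The projection $\mathcal{L}{\upharpoonright}$ of a g-language is the system $(\mathcal{L}{\upharpoonright}_A)_{A\in\mathrm{ptp}(\mathcal{L})}$. The semantics of a system $S$ over $P$ is $[\![S]\!]=\{w\in\Sigma_{int}^\infty \mid \mathrm{ptp}(w)\subseteq P \text{ and } w{\upharpoonright}_A\in S(A)\text{ for all }A\in P\}$. A g-language $\mathcal{L}$ is closed under unknown information (CUI) if for all finite words $w_1\cdot\alpha, w_2\cdot\alpha\in\mathcal{L}$ with the same last interaction $\alpha=A\to B{:}m$, and for all $w\in\mathcal{L}$ with $w{\upharpoonright}_A=w_1{\upharpoonright}_A$ and $w{\upharpoonright}_B=w_2{\upharpoonright}_B$, we have $w\cdot\alpha\in\mathcal{L}$. A language $L\subseteq\Sigma^\infty$ is continuous if $z\in L$ for every $z\in\Sigma^\omega$ such that the set of prefixes of $z$ lying in $L$ is infinite. A g-language is standard or continuous if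 either $\mathcal{L}\subseteq\Sigma_{int}^\star$ or $\mathcal{L}$ is continuous.
   Formalization: Part (2) additionally assumes that the g-language is nonempty: the empty language is a standard, CUI g-language, but its projection has no participants and its semantics contains the empty word, so (2) fails for it. *)

(* Defs.v *)
From mathcomp Require Import all_boot.
From mathcomp Require Import boolp classical_sets functions cardinality.
Set Implicit Arguments.
Unset Strict Implicit.
Unset Printing Implicit Defensive.

Local Open Scope classical_set_scope.

Section Words.
Variable T : Type.

Variant word := Fin of seq T | Inf of (nat -> T).

Definition wcat (v w : word) : word :=
  match v, w with
  | Fin s, Fin t => Fin (s ++ t)
  | Fin s, Inf f =>
      Inf (fun n => if n < size s then nth (f 0) s n else f (n - size s))
  | Inf f, _ => Inf f
  end.

Definition wprefix (v w : word) : Prop := exists u, w = wcat v u.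

Definition prefix_closed (L : set word) : Prop :=
  forall v w, L w -> wprefix v w -> L v.

Definition continuous_lang (L : set word) : Prop :=
  forall f : nat -> T,
    infinite_set [set v | wprefix v (Inf f) /\ L v] -> L (Inf f).

Definition wnth (w : word) (n : nat) : option T :=
  match w with Fin s => onth s n | Inf f => Some (f n) end.

Definition letters (w : word) : set T := [set a | exists n, wnth w n = Some a].

Lemma wprefix_Fin (s t : seq T) :
  wprefix (Fin s) (Fin t) <-> exists u, t = s ++ u.
Proof.
split=> [[[u|f] //= [->]]|[u ->]]; first by exists u.
by exists (Fin u).
Qed.

Lemma wprefix_Inf (s : seq T) (f : nat -> T) :
  wprefix (Fin s) (Inf f) <-> s = mkseq f (size s).
Proof.
split=> [[[//|h] /= [->]]|E].
  apply: (@eq_from_nth _ (h 0)); first by rewrite size_mkseq.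
  by move=> i lti; rewrite nth_mkseq // lti.
exists (Inf (fun n => f (size s + n))) => /=; congr Inf; apply/funext => n.
case: ltnP => [ltn|len]; last by rewrite subnKC.
by rewrite [in RHS]E nth_mkseq.
Qed.

Lemma word_ext (v w : word) :
  (forall s, wprefix (Fin s) v <-> wprefix (Fin s) w) -> v = w.
Proof.
have FI (s : seq T) (f : nat -> T) :
    ~ (forall x, wprefix (Fin x) (Fin s) <-> wprefix (Fin x) (Inf f)).
  move=> /(_ (mkseq f (size s).+1)) [_].
  rewrite wprefix_Inf size_mkseq => /(_ erefl) /wprefix_Fin[u] /(congr1 size).
  by rewrite size_cat size_mkseq => /eqP; rewrite addSn ltn_eqF // ltnS leq_addr.
case: v w => [s|f] [t|g] E.
- have /wprefix_Fin[u Eu] : wprefix (Fin s) (Fin t).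
    by apply/E/wprefix_Fin; exists [::]; rewrite cats0.
  have /wprefix_Fin[u'] : wprefix (Fin t) (Fin s).
    by apply/E/wprefix_Fin; exists [::]; rewrite cats0.
  rewrite Eu -catA -{1}(cats0 s) => /(congr1 (drop (size s))).
  by rewrite !drop_size_cat // => /esym; case: u {Eu} => //= _; rewrite cats0.
- by case: (FI _ _ E).
- by case: (FI t f) => x; split=> /E.
- congr Inf; apply/funext => n.
  have /E/wprefix_Inf : wprefix (Fin (mkseq f n.+1)) (Inf f).
    by rewrite wprefix_Inf size_mkseq.
  by rewrite size_mkseq => /(congr1 (nth (f 0) ^~ n)); rewrite !nth_mkseq.
Qed.

Lemma letters_nil (b : T) : ~ letters (Fin [::]) b.
Proof. by case=> -[]. Qed.

Lemma letters_cons (x : T) (s : seq T) (b : T) :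
  letters (Fin (x :: s)) b <-> x = b \/ letters (Fin s) b.
Proof.
split=> [[[|n] /= E]|[->|[n E]]].
- by left; case: E.
- by right; exists n.
- by exists 0.
- by exists n.+1.
Qed.

Lemma letters_cat (s t : seq T) (b : T) :
  letters (Fin (s ++ t)) b <-> letters (Fin s) b \/ letters (Fin t) b.
Proof.
elim: s => [|x s IHs] /=; first by split=> [|[/letters_nil|]] //; right.
by rewrite !letters_cons IHs; tauto.
Qed.

Lemma letters_Inf (f : nat -> T) (b : T) :
  letters (Inf f) b <-> exists n, letters (Fin (mkseq f n)) b.
Proof.
split=> [[n [<-]]|[n]].
  exists n.+1; rewrite mkseqS -cats1; apply/letters_cat; right.
  by apply/letters_cons; left.
elim: n => [/letters_nil|n IHn] //.
rewrite mkseqS -cats1 => /letters_cat[//|/letters_cons[<-|/letters_nil]] //.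
by exists n.
Qed.

Lemma wprefix_letters (s : seq T) (w : word) :
  wprefix (Fin s) w -> letters (Fin s) `<=` letters w.
Proof.
case: w => [t /wprefix_Fin[u ->] b sb|f /wprefix_Inf E b sb].
  by apply/letters_cat; left.
by apply/letters_Inf; exists (size s); rewrite -E.
Qed.

End Words.

Section Erase.
Variables (T U : Type) (g : T -> option U).

Lemma erase_Inf_exists (f : nat -> T) :
  exists v : word U, forall s : seq U,
    wprefix (Fin s) v <->
    exists n, wprefix (Fin s) (Fin (pmap g (mkseq f n))).
Proof.
pose u n := pmap g (mkseq f n).
have uS n : u n.+1 = u n ++ seq_of_opt (g (f n)).
  rewrite /u mkseqS -cats1 pmap_cat /=; case: (g (f n)) => //.
have u_mono m n : m <= n -> exists t, u n = u m ++ t.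
  elim: n => [|n IHn]; first by rewrite leqn0 => /eqP ->; exists [::]; rewrite cats0.
  rewrite leq_eqVlt => /orP[/eqP ->|]; first by exists [::]; rewrite cats0.
  by rewrite ltnS => /IHn[t E]; rewrite uS E -catA; eexists.
case: (pselect (exists N, forall n, size (u n) <= size (u N))) => [[N bN]|nb].
  exists (Fin (u N)) => s; split=> [?|[n]]; first by exists N.
  rewrite !wprefix_Fin => -[t Et].
  have [leNn|/ltnW leNn] := leqP n N.
    have [t' E] := u_mono _ _ leNn.
    by exists (t ++ t'); rewrite E /u Et catA.
  have [t' E] := u_mono _ _ leNn.
  have := bN n; rewrite E size_cat -[leqRHS]addn0 leq_add2l leqn0 => /nilP t'0.
  by exists t; rewrite -Et -/(u n) E t'0 cats0.
have unb k : exists n, k < size (u n).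
  elim: k => [|k [n IHk]]; apply: contrapT => H; apply: nb.
    exists 0 => n; rewrite leqNgt; apply/negP => lt0.
    by apply: H; exists n; apply: leq_ltn_trans lt0.
  exists n => m; rewrite leqNgt; apply/negP => lt0.
  by apply: H; exists m; apply: leq_ltn_trans lt0.
have [N HN] := choice unb.
have d : U by case: (u (N 0)) (HN 0).
pose h k := nth d (u (N k)) k.
have uh n : u n = mkseq h (size (u n)).
  apply: (@eq_from_nth _ d); first by rewrite size_mkseq.
  move=> i lti; rewrite nth_mkseq // /h.
  have [/u_mono[t ->]|/ltnW /u_mono[t ->]] := leqP n (N i).
    by rewrite nth_cat lti.
  by rewrite nth_cat HN.
have take_mkseq k n : k <= n -> take k (mkseq h n) = mkseq h k.
  by move=> lekn; rewrite /mkseq -map_take take_iota (minn_idPl lekn).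
exists (Inf h) => s; rewrite wprefix_Inf; split=> [E|[n]].
  exists (N (size s)); apply/wprefix_Fin; exists (drop (size s) (u (N (size s)))).
  rewrite -/(u _) -[LHS](cat_take_drop (size s)); congr (_ ++ _).
  by rewrite uh take_mkseq -?E // ltnW.
rewrite wprefix_Fin => -[t Et].
rewrite -[LHS](@take_size_cat _ (size s) s t) // -Et -/(u n) uh take_mkseq //.
by rewrite /u Et size_cat leq_addr.
Qed.

(* The letter-by-letter extension of g to words, None standing for the empty
   word. The image of an infinite word is the (possibly finite) limit of the
   images of its finite prefixes; by word_ext it is characterised by
   erase_InfP. *)
Definition erase (w : word T) : word U :=
  match w with
  | Fin s => Fin (pmap g s)
  | Inf f => sval (cid (erase_Inf_exists f))
  end.

Lemma erase_InfP (f : nat -> T) (s : seq U) :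
  wprefix (Fin s) (erase (Inf f)) <->
  exists n, wprefix (Fin s) (Fin (pmap g (mkseq f n))).
Proof. exact: (svalP (cid (erase_Inf_exists f))). Qed.

Lemma letters_pmap (s : seq T) (b : U) :
  letters (Fin (pmap g s)) b <-> exists2 a, letters (Fin s) a & g a = Some b.
Proof.
elim: s => [|x s IHs] /=; first by split=> [H|[a H]]; case: (letters_nil H).
case E: (g x) => [y|] /=; first rewrite letters_cons; rewrite IHs.
  split=> [[<-|[a sa ga]]|[a /letters_cons[<-|sa] ga]].
  - by exists x => //; apply/letters_cons; left.
  - by exists a => //; apply/letters_cons; right.
  - by left; move: E; rewrite ga => -[].
  - by right; exists a.
split=> [[a sa ga]|[a /letters_cons[<-|sa] ga]].
- by exists a => //; apply/letters_cons; right.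
- by rewrite ga in E.
- by exists a.
Qed.

Lemma letters_erase (w : word T) (b : U) :
  letters (erase w) b <-> exists2 a, letters w a & g a = Some b.
Proof.
case: w => [s|f]; first exact: letters_pmap.
split=> [Eb|[a /letters_Inf[n na] ga]].
  have [s sv sb] : exists2 s, wprefix (Fin s) (erase (Inf f)) & letters (Fin s) b.
    case: (erase (Inf f)) Eb => [s sb|h /letters_Inf[n nb]].
      by exists s => //; apply/wprefix_Fin; exists [::]; rewrite cats0.
    by exists (mkseq h n) => //; apply/wprefix_Inf; rewrite size_mkseq.
  have /erase_InfP[n /wprefix_letters /(_ _ sb) /letters_pmap[a na ga]] := sv.
  by exists a => //; apply/letters_Inf; exists n.
apply: (@wprefix_letters _ (pmap g (mkseq f n))).
  by apply/erase_InfP; exists n; apply/wprefix_Fin; exists [::]; rewrite cats0.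
by apply/letters_pmap; exists a.
Qed.

Lemma erase_prefix_closed (L : set (word T)) :
  prefix_closed L -> prefix_closed (erase @` L).
Proof.
move=> Lpc v _ [w Lw <-].
have finc s t : wprefix (Fin s) (Fin (pmap g t)) -> L (Fin t) ->
    (erase @` L) (Fin s).
  move=> /wprefix_Fin[u E] Lt.
  suff [k Ek] : exists k, pmap g (take k t) = s.
    exists (Fin (take k t)); last by rewrite /= Ek.
    apply: Lpc Lt _; apply/wprefix_Fin; exists (drop k t).
    by rewrite cat_take_drop.
  elim: t s E {Lt} => [|x t IHt] [|y s] //=; try by exists 0.
  case E: (g x) => [z|] /=.
    by case=> <- /IHt[k Ek]; exists k.+1; rewrite /= E /= Ek.
  by move=> /(IHt (y :: s))[k Ek]; exists k.+1; rewrite /= E /= Ek.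
case: v => [s|h]; last by case=> u E; exists w.
case: w Lw => [t Lt st|f Lf]; first exact: finc st Lt.
move=> /erase_InfP[n sn]; apply: finc sn _.
by apply: Lpc Lf _; apply/wprefix_Inf; rewrite size_mkseq.
Qed.

End Erase.

Section Choreographies.
Variables (P : eqType) (M : Type).

Record interaction :=
  Interaction { src : P; dst : P; msg : M; src_neq_dst : src != dst }.

(* For a the interaction A -> B : m, Send a is AB!m and Recv a is AB?m. *)
Variant action := Send of interaction | Recv of interaction.

Definition inter_of (x : action) : interaction :=
  match x with Send a => a | Recv a => a end.

Definition subject (x : action) : P :=
  match x with Send a => src a | Recv a => dst a end.

Definition ptp_int (a : interaction) : set P := [set src a; dst a].
Definition ptp_act (x : action) : set P := ptp_int (inter_of x).

Definition ptp_word T (ptp : T -> set P) (w : word T) : set P :=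
  \bigcup_(a in letters w) ptp a.
Definition ptp_lang T (ptp : T -> set P) (L : set (word T)) : set P :=
  \bigcup_(w in L) ptp_word ptp w.

Definition g_language (L : set (word interaction)) : Prop :=
  prefix_closed L /\ finite_set (ptp_lang ptp_int L).

Definition l_language (L : set (word action)) : Prop :=
  prefix_closed L /\ finite_set (ptp_lang ptp_act L).

Definition local (A : P) (L : set (word action)) : Prop :=
  forall w x, L w -> letters w x -> subject x = A.

(* Only the values of sys_loc on sys_ptp are meaningful. *)
Record system := System {
  sys_ptp : set P;
  sys_loc : P -> set (word action) }.

Definition communicating_system (S : system) : Prop :=
  finite_set (sys_ptp S) /\
  forall A, sys_ptp S A ->
    [/\ l_language (sys_loc S A), local A (sys_loc S A),
        sys_loc S A <> [set Fin [::]]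
      & ptp_lang ptp_act (sys_loc S A) `<=` sys_ptp S].

Definition proj_int (A : P) (a : interaction) : option action :=
  if A == src a then Some (Send a)
  else if A == dst a then Some (Recv a) else None.

Definition proj_word (A : P) : word interaction -> word action :=
  erase (proj_int A).

Definition projection (L : set (word interaction)) : system :=
  System (ptp_lang ptp_int L) (fun A => proj_word A @` L).

Definition semantics (S : system) : set (word interaction) :=
  [set w | ptp_word ptp_int w `<=` sys_ptp S /\
           forall A, sys_ptp S A -> sys_loc S A (proj_word A w)].

Definition correct (S : system) (L : set (word interaction)) : Prop :=
  semantics S `<=` L.

Definition CUI (L : set (word interaction)) : Prop :=
  forall (w1 w2 : seq interaction) (a : interaction) (w : word interaction),
    L (wcat (Fin w1) (Fin [:: a])) -> L (wcat (Fin w2) (Fin [:: a])) -> L w ->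
    proj_word (src a) w = proj_word (src a) (Fin w1) ->
    proj_word (dst a) w = proj_word (dst a) (Fin w2) ->
    L (wcat w (Fin [:: a])).

Definition standard_or_continuous (L : set (word interaction)) : Prop :=
  L `<=` range (@Fin interaction) \/ continuous_lang L.

Lemma proj_intP (A : P) (a : interaction) (x : action) :
  proj_int A a = Some x -> subject x = A /\ inter_of x = a.
Proof.
by rewrite /proj_int; case: eqP => [->|_]; [|case: eqP => [->|//]]; case=> <-.
Qed.

Lemma projection_system (L : set (word interaction)) :
  g_language L -> communicating_system (projection L).
Proof.
move=> [Lpc Lfin]; split=> // A [w0 Lw0 [a0 wa0 a0A]].
have sub : ptp_lang ptp_act (proj_word A @` L) `<=` ptp_lang ptp_int L.
  move=> B [_ [w Lw <-]] [x /letters_erase[a wa /proj_intP[_ xa]] xB].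
  by exists w => //; exists a => //; rewrite -xa.
split=> //.
- by split; [exact: erase_prefix_closed|exact: sub_finite_set Lfin].
- by move=> _ x [w Lw <-] /letters_erase[a _ /proj_intP[]].
- move=> E.
  have : [set Fin [::]] (proj_word A w0) by rewrite -E; exists w0.
  move=> /= E0; have [x Ex] : exists x, proj_int A a0 = Some x.
    rewrite /proj_int; case: eqP => [_|n1]; first by eexists.
    by case: eqP => [_|n2]; [eexists|case: a0A].
  have : letters (proj_word A w0) x by apply/letters_erase; exists a0.
  by rewrite E0 => H; case: (letters_nil H).
Qed.

(* The empty set is prefix-closed, but its projection is the system over no
   participants, whose semantics contains the empty word. *)
Lemma not_correct_set0 : ~ correct (projection set0) set0.
Proof.
move/(_ (Fin [::])); apply; split=> [A [a H]|A [] //].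
by case: (letters_nil H).
Qed.

End Choreographies.

(* Main.v *)
(** For (2), membership of finite words of the semantics goes by induction on
    their length: an interaction [a = A -> B : m] ending such a word is
    witnessed by words [w1 a] and [w2 a] of [L] through the projections on [A]
    and on [B], and CUI glues them. An infinite word of the semantics is a limit
    of its finite prefixes, hence is in [L] if [L] is continuous; it cannot exist
    if [L] is standard, since each of the finitely many participants then has a
    finite local word. *)
Require Import Defs.
From mathcomp Require Import all_boot.
From mathcomp Require Import boolp classical_sets functions cardinality.
Local Open Scope classical_set_scope.

Section Words.
Context {T : Type}.

Lemma wprefix_refl (w : word T) : wprefix w w.
Proof. by exists (Fin [::]); case: w => [s|f] //=; rewrite cats0. Qed.

Lemma wprefix_cat (s t : seq T) : wprefix (Fin s) (Fin (s ++ t)).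
Proof. by exists (Fin t). Qed.

Lemma wprefix_mkseq (f : nat -> T) n : wprefix (Fin (mkseq f n)) (Inf f).
Proof. by apply/wprefix_Inf; rewrite size_mkseq. Qed.

Lemma wprefix_nil (w : word T) : wprefix (Fin [::]) w.
Proof. by case: w => [s|f]; [exact: wprefix_cat|exact: (wprefix_mkseq f 0)]. Qed.

(** Supplies the premise of [continuous_lang]. The prefixes [mkseq f n] realise every size, so a
    finite set of prefixes would make [nat] finite. *)
Lemma infinite_prefixes_Inf (f : nat -> T) (L : set (word T)) :
  (forall n, L (Fin (mkseq f n))) ->
  infinite_set [set v | wprefix v (Inf f) /\ L v].
Proof.
move=> Lf /(finite_image (fun v => if v is Fin s then size s else 0)) fin.
apply: infinite_nat; apply: sub_finite_set fin => n _ /=.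
exists (Fin (mkseq f n)); last exact: size_mkseq.
by split; first exact: wprefix_mkseq.
Qed.

End Words.

Section Erase.
Context {T U : Type} (g : T -> option U).

Lemma erase_wprefix (s : seq T) (w : word T) :
  wprefix (Fin s) w -> wprefix (erase g (Fin s)) (erase g w).
Proof.
case: w => [t /wprefix_Fin[u ->]|f /wprefix_Inf E].
  by rewrite /= pmap_cat; apply: wprefix_cat.
by apply/erase_InfP; exists (size s); rewrite -E; apply: wprefix_refl.
Qed.

Lemma erase_finite_prefix (s : seq U) (w : word T) :
  wprefix (Fin s) (erase g w) ->
  exists2 t, wprefix (Fin t) w & wprefix (Fin s) (Fin (pmap g t)).
Proof.
case: w => [t st|f /erase_InfP[n sn]]; first by exists t => //; apply: wprefix_refl.
by exists (mkseq f n) => //; apply: wprefix_mkseq.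
Qed.

(** A preimage, even an infinite one, can be cut right after the letter that produces [x];
    prefix-closure keeps the cut word in [L]. *)
Lemma erase_image_rcons {L : set (word T)} {p : seq U} {x : U} :
  prefix_closed L -> (erase g @` L) (Fin (rcons p x)) ->
  exists s a, [/\ L (Fin (rcons s a)), pmap g s = p & g a = Some x].
Proof.
move=> Lpc [w Lw Ew].
have [t tw] : exists2 t, wprefix (Fin t) w &
    wprefix (Fin (rcons p x)) (Fin (pmap g t)).
  by apply: erase_finite_prefix; rewrite Ew; apply: wprefix_refl.
have {w Lw Ew tw} : L (Fin t) by apply: Lpc Lw tw.
elim/last_ind: t => [|t b IHt] Lt /wprefix_Fin[u].
  by move/(congr1 size); rewrite size_cat size_rcons.
have {}IHt : wprefix (Fin (rcons p x)) (Fin (pmap g t)) ->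
    exists s a, [/\ L (Fin (rcons s a)), pmap g s = p & g a = Some x].
  by apply: IHt; apply: Lpc Lt _; rewrite -cats1; apply: wprefix_cat.
(* If [b] is erased, or if its image lies beyond [x], the shorter word [t] already produces
   [rcons p x]. Otherwise [b] is the letter sought. *)
rewrite -cats1 pmap_cat /=; case Eb: (g b) => [y|] /=; last first.
  by rewrite cats0 => E; apply: IHt; rewrite E; apply: wprefix_cat.
rewrite cats1; case/lastP: u => [|u z].
  by rewrite cats0 => /rcons_inj[Ep Ex]; exists t, b; rewrite Eb Ex.
rewrite -rcons_cat => /rcons_inj[E _].
by apply: IHt; rewrite E; apply: wprefix_cat.
Qed.

Lemma erase_Inf_Fin_size (f : nat -> T) (s : seq U) n :
  erase g (Inf f) = Fin s -> size (pmap g (mkseq f n)) <= size s.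
Proof.
move=> E; have := erase_wprefix _ _ (wprefix_mkseq f n).
by rewrite E => /wprefix_Fin[u ->]; rewrite size_cat leq_addr.
Qed.

End Erase.

Section Choreographies.
Context {P : eqType} {M : Type}.
Implicit Types (L : set (word (interaction P M))) (a : interaction P M).

Lemma proj_int_src a : proj_int (src a) a = Some (Send a).
Proof. by rewrite /proj_int eqxx. Qed.

Lemma proj_int_dst a : proj_int (dst a) a = Some (Recv a).
Proof. by rewrite /proj_int eq_sym (negPf (src_neq_dst a)) eqxx. Qed.

Lemma ptp_lang_letters {L} {w : word (interaction P M)} {a A} :
  L w -> letters w a -> ptp_int a A -> ptp_lang (@ptp_int P M) L A.
Proof. by move=> Lw wa aA; exists w => //; exists a. Qed.

Lemma semantics_wprefix L s w : prefix_closed L ->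
  semantics (projection L) w -> wprefix (Fin s) w ->
  semantics (projection L) (Fin s).
Proof.
move=> Lpc [wP wL] sw; split=> [A [a sa aA]|A /wL wA].
  by apply: wP; exists a => //; apply: wprefix_letters sw _ sa.
by apply: erase_prefix_closed wA _ => //; apply: erase_wprefix.
Qed.

(** The word [w] followed by [a] lies in the semantics: its local words come from [w1] and [a] at
    the sender, from [w2] and [a] at the receiver, and from [w] elsewhere. For infinite [w],
    appending [a] changes nothing. *)
Lemma correct_CUI L : prefix_closed L -> correct (projection L) L -> CUI L.
Proof.
move=> Lpc Lcor w1 w2 a [w|f] //= L1 L2 Lw EA EB.
have proj_rcons A s t : L (Fin (s ++ [:: a])) ->
    proj_word A (Fin t) = proj_word A (Fin s) ->
    sys_loc (projection L) A (proj_word A (Fin (t ++ [:: a]))).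
  move=> Ls [E]; exists (Fin (s ++ [:: a])) => //.
  by rewrite /proj_word /= !pmap_cat E.
apply: Lcor; split=> [A [b /letters_cat[wb|ab] bA]|A _].
- exact: ptp_lang_letters Lw wb bA.
- apply: ptp_lang_letters L1 _ bA.
  by apply/letters_cat; right.
- have [->|nA] := eqVneq A (src a); first exact: proj_rcons L1 EA.
  have [->|nB] := eqVneq A (dst a); first exact: proj_rcons L2 EB.
  exists (Fin w) => //; rewrite /proj_word /= pmap_cat /=.
  by rewrite /proj_int (negPf nA) (negPf nB) cats0.
Qed.

Lemma CUI_semantics_Fin L s : prefix_closed L -> L !=set0 -> CUI L ->
  semantics (projection L) (Fin s) -> L (Fin s).
Proof.
move=> Lpc [w0 Lw0] LC; elim/last_ind: s => [_|s a IHs semsa].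
  exact: Lpc Lw0 (wprefix_nil w0).
have Ls : L (Fin s).
  by apply/IHs/(semantics_wprefix _ _ _ Lpc semsa); rewrite -cats1; apply: wprefix_cat.
have [saP saL] := semsa.
(* The local word of [A] ends with [x], so it pulls back to a word of [L] whose last interaction
   projects to [x]. That interaction is [a], since an action determines its interaction. *)
have witness A x : ptp_int a A -> proj_int A a = Some x ->
    exists2 t, L (Fin (t ++ [:: a])) & proj_word A (Fin s) = proj_word A (Fin t).
  move=> aA Ax; have /saL : sys_ptp (projection L) A.
    apply: saP; exists a => //; rewrite -cats1.
    by apply/letters_cat; right; apply/letters_cons; left.
  rewrite /proj_word /= -cats1 pmap_cat /= Ax /= cats1.
  move=> /(erase_image_rcons _ Lpc)[t [b [Lt Et /proj_intP[_ xb]]]].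
  have [_ xa] := proj_intP Ax.
  by exists t; rewrite ?Et // -xa xb cats1.
have [w1 L1 E1] := witness _ _ (or_introl erefl) (proj_int_src a).
have [w2 L2 E2] := witness _ _ (or_intror erefl) (proj_int_dst a).
by rewrite -cats1; exact: LC L1 L2 Ls E1 E2.
Qed.

(** Each interaction contributes a [Send] to the projection on its sender. *)
Lemma size_projections (f : nat -> interaction P M) (r : seq P) n :
  (forall k, src (f k) \in r) ->
  n <= \sum_(A <- r) size (pmap (proj_int A) (mkseq f n)).
Proof.
move=> fr; elim: n => // n IHn.
under eq_bigr => A _ do rewrite mkseqS -cats1 pmap_cat size_cat.
rewrite big_split /= -addn1 leq_add //.
by rewrite (big_rem _ (fr n)) /= proj_int_src.
Qed.

Lemma standard_semantics_Inf L (f : nat -> interaction P M) :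
  finite_set (ptp_lang (@ptp_int P M) L) ->
  L `<=` range (@Fin (interaction P M)) ->
  ~ semantics (projection L) (Inf f).
Proof.
move=> /finite_seqP[r Er] Lfin [fP fL].
have fr k : src (f k) \in r.
  suff : ptp_lang (@ptp_int P M) L (src (f k)) by rewrite Er.
  by apply: fP; exists (f k); [exists k|left].
(* [K A] bounds the length of the local word of [A], which is finite as the projection of a finite
   word of [L]; outside [r] it is a dummy 0. *)
have /choice[K HK] A : exists k, A \in r ->
    forall n, size (pmap (proj_int A) (mkseq f n)) <= k.
  have [Ar|] := boolP (A \in r); last by exists 0.
  have /fL[w /[dup] Lw /Lfin[s _ Es] Ef] : sys_ptp (projection L) A.
    by rewrite /= Er.
  exists (size (pmap (proj_int A) s)) => _ n; apply: erase_Inf_Fin_size.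
  by rewrite -/(proj_word A _) -Ef -Es.
(* A prefix one letter longer than the sum of all the bounds is too long. *)
have := size_projections _ _ (\sum_(A <- r) K A).+1 fr.
rewrite ltnNge => /negP; apply.
by rewrite big_seq [leqRHS]big_seq; apply: leq_sum => A Ar; apply: HK.
Qed.

Lemma CUI_correct L : g_language L -> L !=set0 -> standard_or_continuous L ->
  CUI L -> correct (projection L) L.
Proof.
move=> [Lpc Lfin] L0 Lsc LC [s|f] semw; first exact: CUI_semantics_Fin semw.
case: Lsc => [Lstd|Lcont]; first by case: (standard_semantics_Inf _ _ Lfin Lstd semw).
apply/Lcont/infinite_prefixes_Inf => n; apply: CUI_semantics_Fin => //.
exact: semantics_wprefix Lpc semw (wprefix_mkseq f n).
Qed.

End Choreographies.

(** The second half assumes [L] nonempty because [set0] satisfies all its other hypotheses, while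
    [not_correct_set0] refutes its conclusion. *)
Theorem theorem3p7 (P : eqType) (M : Type) (L : set (word (interaction P M)))
    (hL : g_language L) :
  (correct (projection L) L -> CUI L) /\
  (L !=set0 -> standard_or_continuous L -> CUI L -> correct (projection L) L).
Proof. by split; [apply: correct_CUI; case: hL|exact: CUI_correct]. Qed.
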